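(* There exist an online algorithm and an absolute constant $C>0$ such that for every instance of online covering with $\ell_q$-norm objectives, every advice $x'\in\mathbb{R}^n_{\ge0}$ and every $\lambda\in(0,1)$, the final solution $\bar x$ is feasible ($A\bar x\ge\mathbf 1$) and $$f(\bar x)\le\min\Big\{\tfrac{C}{1-\lambda}f(x')+C\big(1+\log(\kappa d)\big)\mathsf{OPT},\ C\big(1+\log\tfrac{\kappa d}{\lambda}\big)\mathsf{OPT}\Big\}.$$ Moreover, if $Ax'\ge\mathbf 1$ then $f(\bar x)\le \frac{C}{1-\lambda}f(x')$.
   Context: Online covering with $\ell_q$-norm objectives: minimize $f(x)=\sum_{e=1}^r c_e\|x(S_e)\|_{q_e}$ over $x\in\mathbb{R}^n_{\ge0}$ subject to $Ax\ge\mathbf 1$, where $A=(a_{ij})\in\mathbb{R}^{m\times n}_{\ge0}$, each $S_e\subseteq[n]$, $q_e\ge1$, $c_e\ge0$, $x(S)$ is the restriction of $x$ to the coordinates in $S$, and $\|x(S)\|_q=(\sum_{i\in S}x_i^q)^{1/q}$. The sets $S_e$ need not be disjoint. $\kappa:=a_{\max}/a_{\min}$ with $a_{\max}$ and $a_{\min}$ the largest and smallest nonzero entries of $A$; $d:=\max\{\max_{i\in[m]}|\{j:a_{ij}>0\}|,\ \max_{e\in[r]}|S_e|\}$. Online model: $f$ (i.e. $r$, $c_e$, $S_e$, $q_e$), $n$, advice $x'$ and $\lambda$ are given in advance; the rows of $A$ arrive one at a time ($m$ unknown); after each arrival the algorithm must increase $x$ coordinatewise (never decrease) so that all revealed constraints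 hold, using only revealed information; $\bar x$ is the final vector. $\mathsf{OPT}=\min\{f(x): x\ge0, Ax\ge \mathbf 1\}$. *)

(* Defs.v *)
From HB Require Import structures.
From mathcomp Require Import all_boot all_order all_algebra.
From mathcomp Require Import all_classical all_reals all_analysis.
Set Implicit Arguments. Unset Strict Implicit. Unset Printing Implicit Defensive.
Import Order.TTheory GRing.Theory Num.Theory.
Local Open Scope classical_set_scope.
Local Open Scope ring_scope.

Section Covering.
Variable R : realType.

Definition lqnorm (n : nat) (S : {set 'I_n}) (q : R) (x : 'I_n -> R) : R :=
  (\sum_(i in S) x i `^ q) `^ (q^-1).

Definition fobj (n r : nat) (c : 'I_r -> R) (S : 'I_r -> {set 'I_n})
    (q : 'I_r -> R) (x : 'I_n -> R) : R :=
  \sum_(e < r) c e * lqnorm (S e) (q e) x.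

Definition row_val (n : nat) (a : 'I_n -> R) (x : 'I_n -> R) : R :=
  \sum_(j < n) a j * x j.

Definition feasible (n : nat) (rows : seq ('I_n -> R)) (x : 'I_n -> R) : Prop :=
  (forall j, 0 <= x j) /\ all (fun a => 1 <= row_val a x) rows.

Definition valid_row (n : nat) (a : 'I_n -> R) : Prop :=
  (forall j, 0 <= a j) /\ (exists j, 0 < a j).

Definition valid_rows (n : nat) (rows : seq ('I_n -> R)) : Prop :=
  forall k, (k < size rows)%N -> valid_row (nth (fun=> 0) rows k).

Definition OPT (n r : nat) (c : 'I_r -> R) (S : 'I_r -> {set 'I_n})
    (q : 'I_r -> R) (rows : seq ('I_n -> R)) : R :=
  inf [set fobj c S q y | y in [set y | feasible rows y]].

Definition amax (n : nat) (rows : seq ('I_n -> R)) : R :=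
  \big[Num.max/0]_(a <- rows) \big[Num.max/0]_(j < n) a j.
Definition amin (n : nat) (rows : seq ('I_n -> R)) : R :=
  \big[Num.min/amax rows]_(a <- rows) \big[Num.min/amax rows]_(j < n | a j != 0) a j.
Definition kappa (n : nat) (rows : seq ('I_n -> R)) : R := amax rows / amin rows.

Definition dpar (n r : nat) (S : 'I_r -> {set 'I_n}) (rows : seq ('I_n -> R)) : nat :=
  maxn (\big[maxn/0%N]_(a <- rows) #|[set j | a j != 0]|)
       (\big[maxn/0%N]_(e < r) #|S e|).

End Covering.

(* An online algorithm: given the information known in advance
   (n, the objective (r, c, S, q), advice x', lambda) and the list of rows
   revealed so far (in arrival order), it returns the current vector x.
   Since it only sees the revealed prefix, it uses only revealed information
   and does not know m. *)
Definition OnlineAlg (R : realType) : Type :=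
  forall (n r : nat), ('I_r -> R) -> ('I_r -> {set 'I_n}) -> ('I_r -> R) ->
    ('I_n -> R) -> R -> seq ('I_n -> R) -> ('I_n -> R).

(* Main.v *)
(** Write the objective as [f = \sum_e c_e N_e].  On a violated row [a] with [d_a] nonzero
    entries, [x] follows a discretization of the flow
    [dx_j/dt = (a_j x_j + 1/d_a) / (grad f x)_j], so that [f] grows at rate at most [2].
    For a feasible [z] and [delta <= 1/(d a_max)], set
    [Phi x = \sum_e c_e N_e(z) (ln (N_e(x) + delta) + \sum_j v_j^q ln (x_j + delta))]
    with [v = z / N_e(z)].  Young's inequality [u^(q-1) v <= u^q + v^q] with [u = x / N_e(x)],
    together with [\sum_j u_j^q d(ln x_j) = d(ln N_e(x))], shows that [Phi] grows at least at
    rate [\sum_j a_j z_j >= 1] up to a constant.  Hence the cost is [O(Phi(end) - Phi(start))],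
    which is [O(1 + ln (kappa d)) f(z)].  The algorithm needs neither [kappa] nor [d], and the
    potential never requires the sets [S_e] to be disjoint.

    The advice is then used by switching: follow this algorithm as long as it is cheaper than
    the advice; afterwards play the advice plus the last cheap output, and once the advice is
    violated, the advice plus the current output.  By subadditivity of [f] the cost is at most
    twice that of the algorithm without advice, at most the sum of the two costs, and at most
    twice that of the advice as long as the advice is feasible. *)

Require Import Defs.
From HB Require Import structures.
From mathcomp Require Import all_boot all_order all_algebra.
From mathcomp Require Import all_classical all_reals all_analysis.
From mathcomp Require Import ring lra.
Import Order.TTheory GRing.Theory Num.Theory.
Local Open Scope classical_set_scope.
Local Open Scope ring_scope.

Set Implicit Arguments.
Unset Strict Implicit.
Unset Printing Implicit Defensive.

(** * The [l_q] norm: Minkowski's inequality and first-order estimates *)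

Section LqNorm.
Variable R : realType.

(** Young's inequality for the conjugate exponents [q / (q - 1)] and [q]. At [q = 1] the first
    exponent degenerates, and both sides equal [v]. *)
Lemma young_powR (q u v : R) : 1 <= q -> 0 <= u -> 0 <= v ->
  u `^ (q - 1) * v <= (1 - q^-1) * u `^ q + q^-1 * v `^ q.
Proof.
move=> q1 u0 v0; have q0 : 0 < q by lra.
have [->|qn1] := eqVneq q 1.
  by rewrite subrr invr1 powRr0 subrr mul0r add0r !mul1r powRr1.
have q1' : 0 < q - 1 by rewrite subr_gt0 lt_neqAle eq_sym qn1.
have p0 : 0 < q / (q - 1) by rewrite divr_gt0.
have pq : (q / (q - 1))^-1 + q^-1 = 1.
  by rewrite invf_div; field; rewrite gt_eqF.
have := @conjugate_powR R (u `^ (q - 1)) v _ _ (powR_ge0 _ _) v0 p0 q0 pq.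
rewrite -powRrM (_ : (q - 1) * (q / (q - 1)) = q); last by rewrite mulrCA mulfV ?mulr1 ?gt_eqF.
rewrite (_ : (q / (q - 1))^-1 = 1 - q^-1); last by apply/eqP; rewrite eq_sym subr_eq; apply/eqP.
by rewrite mulrC [v `^ q / q]mulrC [u `^ q * _]mulrC mulrC.
Qed.

Lemma young_powR_le (q u v : R) : 1 <= q -> 0 <= u -> 0 <= v ->
  u `^ (q - 1) * v <= u `^ q + v `^ q.
Proof.
move=> q1 u0 v0; apply: le_trans (young_powR q1 u0 v0) _.
have q0 : 0 < q by lra.
have iq0 : 0 < q^-1 by rewrite invr_gt0.
have iq1 : q^-1 <= 1 by rewrite invf_le1.
have := powR_ge0 u q; have := powR_ge0 v q; nra.
Qed.

Variables (n : nat) (S : {set 'I_n}) (q : R).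
Hypothesis q1 : 1 <= q.
Implicit Types x y z v : 'I_n -> R.
Local Notation N := (lqnorm S q).

Let q0 : 0 < q. Proof. exact: lt_le_trans ltr01 q1. Qed.

Lemma lqnorm_ge0 x : 0 <= N x.
Proof. exact: powR_ge0. Qed.

Lemma lqnorm_powR x : N x `^ q = \sum_(i in S) x i `^ q.
Proof.
rewrite /lqnorm -powRrM mulVf ?gt_eqF// powRr1//.
by apply: sumr_ge0 => i _; exact: powR_ge0.
Qed.

Lemma le_lqnorm x y : (forall j, j \in S -> 0 <= x j <= y j) -> N x <= N y.
Proof.
move=> xy; apply: ge0_ler_powR.
- by rewrite invr_ge0 ltW.
- by rewrite nnegrE sumr_ge0// => i _; exact: powR_ge0.
- by rewrite nnegrE sumr_ge0// => i _; exact: powR_ge0.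
- apply: ler_sum => i iS; have /andP[x0 xyi] := xy i iS.
  by apply: ge0_ler_powR; rewrite ?nnegrE ?(ltW q0) ?(le_trans x0 xyi).
Qed.

Lemma eq_lqnorm x y : (forall j, j \in S -> x j = y j) -> N x = N y.
Proof. by move=> xy; congr powR; apply: eq_bigr => i iS; rewrite xy. Qed.

Lemma lqnormZ k x : 0 <= k -> (forall j, 0 <= x j) ->
  N (fun j => k * x j) = k * N x.
Proof.
move=> k0 x0; rewrite /lqnorm.
under eq_bigr do rewrite powRM//.
rewrite -mulr_sumr powRM ?powR_ge0//; last first.
  by apply: sumr_ge0 => i _; exact: powR_ge0.
by rewrite -powRrM mulfV ?gt_eqF// powRr1.
Qed.

Lemma lqnorm0 : N (fun=> 0) = 0.
Proof.
by rewrite /lqnorm big1 ?powR0 ?invr_eq0 ?gt_eqF// => i _; rewrite powR0 ?gt_eqF.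
Qed.

Lemma coord_le_lqnorm x j : (forall j, 0 <= x j) -> j \in S -> x j <= N x.
Proof.
move=> x0 jS.
have -> : x j = (x j `^ q) `^ q^-1 by rewrite -powRrM mulfV ?gt_eqF// powRr1.
apply: ge0_ler_powR.
- by rewrite invr_ge0 ltW.
- by rewrite nnegrE powR_ge0.
- by rewrite nnegrE sumr_ge0// => i _; exact: powR_ge0.
- by rewrite (bigD1 j)//= lerDl sumr_ge0// => i _; exact: powR_ge0.
Qed.

Lemma lqnorm_gt0 x j : (forall j, 0 < x j) -> j \in S -> 0 < N x.
Proof.
move=> x0 jS; apply: lt_le_trans (x0 j) _; apply: coord_le_lqnorm => // i.
exact: ltW.
Qed.

Lemma lqnorm_empty x : S = finset.set0 -> N x = 0.
Proof. by move=> S0; rewrite -lqnorm0; apply: eq_lqnorm => j; rewrite S0 finset.in_set0. Qed.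

Lemma lqnorm_le_card x X : (forall j, 0 <= x j) -> (forall j, x j <= X) -> 0 <= X ->
  N x <= #|S|%:R * X.
Proof.
move=> x0 xX X0; have [S0|[i iS]] := set_0Vmem S.
  by rewrite lqnorm_empty// mulr_ge0.
have cS : 1 <= (#|S|%:R : R).
  by rewrite ler1n card_gt0; apply/set0Pn; exists i.
apply: (@le_trans _ _ (N (fun=> X * 1))).
  by apply: le_lqnorm => j _; rewrite mulr1 x0 xX.
rewrite (@lqnormZ _ (fun=> 1))// mulrC ler_wpM2r//.
rewrite /lqnorm powR1 sumr_const -[leRHS]powRr1//.
by apply: ler_powR; rewrite ?invf_le1.
Qed.

Lemma sum_lqnorm_unit x : (forall j, 0 <= x j) -> 0 < N x ->
  \sum_(j in S) (x j / N x) `^ q = 1.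
Proof.
move=> x0 Nx; have Ni : 0 <= (N x)^-1 by rewrite invr_ge0 ltW.
under eq_bigr do rewrite powRM//.
rewrite -mulr_suml -lqnorm_powR -powRM ?lqnorm_ge0// mulfV ?powR1//.
by rewrite gt_eqF.
Qed.

(* [(z/N z)^(q-1)] is the gradient of the norm at [z], an element of the dual unit ball. *)
Lemma lqnorm_grad_le z v : (forall j, 0 <= z j) -> 0 < N z ->
  (forall j, 0 <= v j) -> \sum_(j in S) (z j / N z) `^ (q - 1) * v j <= N v.
Proof.
move=> z0 Nz v0.
have [Nv|Nv] := eqVneq (N v) 0.
  rewrite Nv big1// => j jS; suff -> : v j = 0 by rewrite mulr0.
  apply/eqP; rewrite eq_le v0 andbT -Nv; exact: coord_le_lqnorm.
have Nv0 : 0 < N v by rewrite lt_neqAle eq_sym Nv lqnorm_ge0.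
rewrite -[leRHS]mulr1 -ler_pdivrMl// mulr_sumr.
apply: (@le_trans _ _ (\sum_(j in S)
   ((1 - q^-1) * (z j / N z) `^ q + q^-1 * (v j / N v) `^ q))); last first.
  rewrite big_split/= -[X in X + _]mulr_sumr -[X in _ + X]mulr_sumr.
  by rewrite [X in _ * X + _](sum_lqnorm_unit z0 Nz) (sum_lqnorm_unit v0 Nv0) !mulr1 subrK.
apply: ler_sum => j jS.
have -> : (N v)^-1 * ((z j / N z) `^ (q - 1) * v j)
  = (z j / N z) `^ (q - 1) * (v j / N v) by ring.
by apply: (young_powR q1); [exact: divr_ge0 (ltW Nz)|exact: divr_ge0 (ltW Nv0)].
Qed.

Lemma lqnorm_grad_self z : (forall j, 0 <= z j) -> 0 < N z ->
  \sum_(j in S) (z j / N z) `^ (q - 1) * z j = N z.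
Proof.
move=> z0 Nz.
have E j : j \in S -> (z j / N z) `^ (q - 1) * z j = N z * (z j / N z) `^ q.
  move=> _; rewrite -(@mulr_powRB1 _ (z j / N z) q (divr_ge0 (z0 j) (ltW Nz)) q0).
  by field; rewrite gt_eqF.
by rewrite (eq_bigr _ E) -mulr_sumr (sum_lqnorm_unit z0 Nz) mulr1.
Qed.

(** Duality: the gradient at [x + y] is a linear functional that attains the norm there and is
    bounded by the norm on [x] and on [y] separately. *)
Lemma lqnormD x y : (forall j, 0 <= x j) -> (forall j, 0 <= y j) ->
  N (fun j => x j + y j) <= N x + N y.
Proof.
move=> x0 y0; set z := fun j => _.
have z0 j : 0 <= z j by rewrite addr_ge0.
have [Nz|Nz] := eqVneq (N z) 0; first by rewrite Nz addr_ge0 ?lqnorm_ge0.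
have Nz0 : 0 < N z by rewrite lt_neqAle eq_sym Nz lqnorm_ge0.
rewrite -(lqnorm_grad_self z0 Nz0); under eq_bigr do rewrite [X in _ * X]/z mulrDr.
by rewrite big_split; exact: lerD (lqnorm_grad_le z0 Nz0 x0) (lqnorm_grad_le z0 Nz0 y0).
Qed.

(** Convexity: the tangent at [x] lies below the norm. *)
Lemma lqnorm_incr_ge x y : (forall j, 0 <= x j) -> 0 < N x -> (forall j, 0 <= y j) ->
  \sum_(j in S) (x j / N x) `^ (q - 1) * (y j - x j) <= N y - N x.
Proof.
move=> x0 Nx y0; under eq_bigr do rewrite mulrBr.
by rewrite sumrB (lqnorm_grad_self x0 Nx); exact: lerB (lqnorm_grad_le x0 Nx y0) (lexx _).
Qed.

(** Convexity at [y] bounds the increase by the gradient at [y]. Since [N x <= N y] and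
    [y j <= rho * x j], that gradient is at most [rho^(q-1) <= 2] times the gradient at [x]. *)
Lemma lqnorm_incr_le (rho : R) x y : (forall j, 0 < x j) ->
  (forall j, x j <= y j <= rho * x j) -> rho `^ q <= 2 ->
  N y - N x <= 2 * \sum_(j in S) (x j / N x) `^ (q - 1) * (y j - x j).
Proof.
move=> x0 xy rho2.
have [S0|[i iS]] := set_0Vmem S.
  by rewrite (lqnorm_empty x S0) (lqnorm_empty y S0) S0 big_set0 mulr0 subrr.
have y0 j : 0 < y j by have /andP[+ _] := xy j; apply: lt_le_trans.
have Nx := lqnorm_gt0 x0 iS; have Ny := lqnorm_gt0 y0 iS.
have rho1 : 1 <= rho.
  have /andP[a b] := xy i; have := le_trans a b.
  by rewrite -{1}[x i]mul1r ler_pM2r.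
have NN : N x <= N y by apply: le_lqnorm => j _; rewrite ltW//; case/andP: (xy j).
apply: (@le_trans _ _ (\sum_(j in S) (y j / N y) `^ (q - 1) * (y j - x j))).
  have := @lqnorm_incr_ge y x (fun j => ltW (y0 j)) Ny (fun j => ltW (x0 j)).
  rewrite -lerN2 opprB -sumrN; under eq_bigr do rewrite -mulrN opprB.
  by [].
rewrite mulr_sumr ler_sum// => j jS; rewrite mulrA ler_wpM2r//.
  by rewrite subr_ge0; case/andP: (xy j).
have rho0 := le_trans ler01 rho1.
have ux : 0 <= x j / N x := divr_ge0 (ltW (x0 j)) (ltW Nx).
have uy : 0 <= y j / N y := divr_ge0 (ltW (y0 j)) (ltW Ny).
have uyx : y j / N y <= rho * (x j / N x).
  move: NN Nx Ny {ux uy}; move: (N x) (N y) => s t st s0 t0.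
  rewrite mulrA; apply: ler_pM; [exact: ltW|by rewrite invr_ge0 ltW| |].
    by case/andP: (xy j).
  by rewrite lef_pV2 ?posrE.
move: ux uy uyx; move: (x j / N x) (y j / N y) => u w ux uy uyx.
have q10 : 0 <= q - 1 by rewrite subr_ge0.
apply: (@le_trans _ _ ((rho * u) `^ (q - 1))).
  by apply: ge0_ler_powR; rewrite ?nnegrE// mulr_ge0.
rewrite powRM// ler_wpM2r ?powR_ge0//; apply: le_trans rho2.
by apply: ler_powR => //; rewrite gerBl ler01.
Qed.

End LqNorm.

(** * Growth and range of the logarithmic potential of one norm *)

Section NormPotential.
Variable R : realType.

(** From [ln t <= t - 1] at [t = a / b] one gets [ln b - ln a >= (b - a) / b]; replacing the
    denominator [b] by [a] costs the factor 2. *)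
Lemma ln_incr_ge (a b : R) : 0 < a -> a <= b <= 2 * a ->
  (b - a) / a <= 2 * (ln b - ln a).
Proof.
move=> a0 /andP[ab b2a]; have b0 : 0 < b := lt_le_trans a0 ab.
have ab0 : 0 < a / b by rewrite divr_gt0.
have := @le_ln1Dx R (a / b - 1); rewrite [1 + _]addrC subrK ltrBrDr addNr ab0.
move=> /(_ isT); rewrite ln_div ?posrE// => H.
have : (b - a) / a <= 2 * (1 - a / b).
  rewrite ler_pdivrMr//.
  have -> : 2 * (1 - a / b) * a = 2 * a / b * (b - a) by field; rewrite gt_eqF.
  by rewrite ler_peMl ?subr_ge0// ler_pdivlMr// mul1r.
move/le_trans; apply; rewrite ler_pM2l//; lra.
Qed.

Variables (n : nat) (S : {set 'I_n}) (q : R).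
Hypothesis q1 : 1 <= q.
Implicit Types x y z : 'I_n -> R.
Local Notation N := (lqnorm S q).

Definition lqpot (delta : R) z x : R :=
  N z * (ln (N x + delta) + \sum_(j in S) (z j / N z) `^ q * ln (x j + delta)).

(** Discrete form of [\sum_j u_j^q d(ln x_j) = d(ln N)], shifted by [delta]. As [x j <= N x], the
    ratio [x j / (x j + delta)] is at most [N x / (N x + delta)], which moves the shift from the
    coordinates to the norm; convexity and [ln_incr_ge] do the rest. *)
Lemma sum_grad_log_incr (delta : R) x y : 0 < delta -> (forall j, 0 < x j) ->
  (forall j, x j <= y j <= 2 * x j) ->
  \sum_(j in S) (x j / N x) `^ q * ((y j - x j) / (x j + delta))
  <= 2 * (ln (N y + delta) - ln (N x + delta)).
Proof.
move=> d0 x0 xy; have x0' j := ltW (x0 j).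
have xy' j : x j <= y j by case/andP: (xy j).
have y0 j : 0 <= y j := le_trans (x0' j) (xy' j).
have [S0|[i iS]] := set_0Vmem S.
  by rewrite (lqnorm_empty q1 x S0) (lqnorm_empty q1 y S0) S0 big_set0 subrr mulr0.
have Nx := lqnorm_gt0 q1 x0 iS.
have NN : N x <= N y by apply: (le_lqnorm q1) => j _; rewrite x0' xy'.
have N2 : N y <= 2 * N x.
  have <- := @lqnormZ R n S q q1 2 x (ler0n R 2) x0'.
  by apply: (le_lqnorm q1) => j _; rewrite y0; case/andP: (xy j).
have Nd : 0 < N x + delta := addr_gt0 Nx d0.
apply: (@le_trans _ _ ((N y + delta - (N x + delta)) / (N x + delta))); last first.
  by apply: (ln_incr_ge Nd); move: (N x) (N y) {Nd} Nx NN N2 => s t ? ? ?; lra.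
have E (s t u : R) : s + u - (t + u) = s - t by ring.
rewrite E; apply: (@le_trans _ _
   ((\sum_(j in S) (x j / N x) `^ (q - 1) * (y j - x j)) / (N x + delta))); last first.
  apply: ler_wpM2r; first by rewrite invr_ge0 ltW.
  exact: (lqnorm_incr_ge q1 x0' Nx y0).
rewrite mulr_suml; apply: ler_sum => j jS.
have xN := coord_le_lqnorm q1 x0' jS.
have q0 : 0 < q := lt_le_trans ltr01 q1.
rewrite -(mulr_powRB1 (divr_ge0 (x0' j) (ltW Nx)) q0) [X in X * _ <= _]mulrC.
rewrite -!mulrA; apply: ler_wpM2l; first exact: powR_ge0.
move: (N x) Nx Nd xN => s s0 sd xs.
have xd : 0 < x j + delta by rewrite addr_gt0.
have -> : x j * (s^-1 * ((y j - x j) / (x j + delta)))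
  = (y j - x j) * (x j / (s * (x j + delta))).
  by field; rewrite !gt_eqF.
rewrite ler_wpM2l ?subr_ge0// ler_pdivrMr ?mulr_gt0// mulrC ler_pdivlMr//.
by rewrite !mulrDr [x j * s]mulrC lerD2l ler_wpM2r// ltW.
Qed.

(** Young's inequality splits the left side into a sum weighted by [(x j / N x)^q], paid by the
    logarithm of the norm, and one weighted by [(z j / N z)^q], paid by the logarithms of the
    coordinates. *)
Lemma lqpot_incr (delta : R) x y z : 0 < delta -> (forall j, 0 < x j) ->
  (forall j, x j <= y j <= 2 * x j) -> (forall j, 0 <= z j) ->
  \sum_(j in S) (x j / N x) `^ (q - 1) * (z j * ((y j - x j) / (x j + delta)))
  <= 2 * (lqpot delta z y - lqpot delta z x).
Proof.
move=> d0 x0 xy z0; have x0' j := ltW (x0 j).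
rewrite /lqpot -mulrBr opprD addrACA -sumrB.
have [Nz|Nz] := eqVneq (N z) 0.
  rewrite Nz mul0r mulr0 big1// => j jS.
  have -> : z j = 0.
    by apply/eqP; rewrite eq_le z0 andbT -Nz; exact: (coord_le_lqnorm q1).
  by rewrite mul0r mulr0.
have Nz0 : 0 < N z by rewrite lt_neqAle eq_sym Nz (lqnorm_ge0 S q).
pose w j := (y j - x j) / (x j + delta).
have xd j : 0 < x j + delta by rewrite addr_gt0.
have w0 j : 0 <= w j.
  by apply: divr_ge0; [rewrite subr_ge0; case/andP: (xy j)|exact: ltW].
apply: (@le_trans _ _ (N z * (\sum_(j in S) (x j / N x) `^ q * w j +
    \sum_(j in S) (z j / N z) `^ q * w j))).
  rewrite -big_split mulr_sumr /=; apply: ler_sum => j _; rewrite -mulrDl.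
  have ux : 0 <= x j / N x := divr_ge0 (x0' j) (lqnorm_ge0 S q x).
  have uz : 0 <= z j / N z := divr_ge0 (z0 j) (lqnorm_ge0 S q z).
  have := ler_wpM2r (w0 j) (young_powR_le q1 ux uz).
  rewrite -(ler_pM2l Nz0); apply: le_trans.
  rewrite le_eqVlt; apply/orP; left; apply/eqP.
  rewrite -/(w j); move: (_ `^ (q - 1)) => g.
  by move: (N z) Nz {Nz0 uz} => s s0; field.
rewrite [leRHS]mulrCA ler_pM2l// mulrDr; apply: lerD.
  exact: sum_grad_log_incr.
rewrite mulr_sumr; apply: ler_sum => j _.
rewrite -mulrBr [leRHS]mulrCA ler_wpM2l ?powR_ge0//.
have := @ln_incr_ge (x j + delta) (y j + delta) (xd j).
rewrite opprD addrACA subrr addr0; apply; case/andP: (xy j) => a b.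
rewrite lerD2r a/=; move: (x j) (y j) {a x0 x0' xd w w0 xy} b => s t; lra.
Qed.

(** Each shifted logarithm starts at [ln delta] or above and ends at [ln (D * X + delta)] or below.
    The weights [(z j / N z)^q] sum to 1, so the norm part and the coordinate part contribute one
    logarithm each. *)
Lemma lqpot_range (delta X D : R) x0 x z : 0 < delta -> 0 <= X -> 1 <= D ->
  #|S|%:R <= D -> (forall j, 0 <= x0 j) -> (forall j, 0 <= x j <= X) ->
  (forall j, 0 <= z j) ->
  lqpot delta z x - lqpot delta z x0 <= N z * (2 * ln (1 + D * X / delta)).
Proof.
move=> d0 X0 D1 SD x00 xX z0.
rewrite /lqpot -mulrBr opprD addrACA -sumrB.
have [Nz|Nz] := eqVneq (N z) 0; first by rewrite Nz !mul0r.
have Nz0 : 0 < N z by rewrite lt_neqAle eq_sym Nz (lqnorm_ge0 S q).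
rewrite ler_pM2l// mulr2n mulrDl mul1r.
have DX0 : 0 <= D * X / delta.
  by apply: divr_ge0 (ltW d0); exact: mulr_ge0 (le_trans ler01 D1) X0.
have key s s0 : 0 <= s0 -> 0 <= s -> s <= D * X ->
    ln (s + delta) - ln (s0 + delta) <= ln (1 + D * X / delta).
  move=> s00 sp sD.
  have sd : 0 < s + delta by rewrite ltr_wpDl.
  have sd0 : 0 < s0 + delta by rewrite ltr_wpDl.
  rewrite -ln_div ?posrE// ler_ln ?posrE ?divr_gt0//; last first.
    by rewrite ltr_wpDr.
  rewrite ler_pdivrMr// (@le_trans _ _ ((1 + D * X / delta) * delta))//.
    by rewrite mulrDl mul1r divfK ?gt_eqF// addrC lerD2l.
  by rewrite ler_wpM2l ?lerDr// addr_ge0.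
have x0' j : 0 <= x j by case/andP: (xX j).
have xX' j : x j <= X by case/andP: (xX j).
apply: lerD.
  apply: key; [exact: lqnorm_ge0|exact: lqnorm_ge0|].
  apply: (le_trans (lqnorm_le_card S q1 x0' xX' X0)).
  by rewrite ler_wpM2r.
rewrite -[leRHS]mul1r -[X in _ <= X * _](sum_lqnorm_unit q1 z0 Nz0) mulr_suml; apply: ler_sum => j _.
rewrite -mulrBr ler_wpM2l ?powR_ge0//; apply: key => //.
by rewrite (le_trans (xX' j))// ler_peMl.
Qed.

End NormPotential.

(** * The objective: the estimates for one norm, summed over [e] *)

Section Objective.
Variables (R : realType) (n r : nat) (c : 'I_r -> R) (S : 'I_r -> {set 'I_n}).
Variable q : 'I_r -> R.
Hypotheses (c0 : forall e, 0 <= c e) (q1 : forall e, 1 <= q e).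
Implicit Types x y z h : 'I_n -> R.
Local Notation f := (fobj c S q).

(** The coordinates that [f] depends on. At positive vectors the gradient is positive there, so the
    flow may divide by it. *)
Definition costly (j : 'I_n) : bool := [exists e, (0 < c e) && (j \in S e)].

Definition fgrad x j : R :=
  \sum_(e < r | j \in S e) c e * (x j / lqnorm (S e) (q e) x) `^ (q e - 1).

Definition fpot (delta : R) z x : R :=
  \sum_(e < r) c e * lqpot (S e) (q e) delta z x.

Lemma fobj_ge0 x : 0 <= f x.
Proof. by apply: sumr_ge0 => e _; apply: mulr_ge0 => //; exact: lqnorm_ge0. Qed.

Lemma fobj0 : f (fun=> 0) = 0.
Proof. by rewrite /fobj big1// => e _; rewrite (lqnorm0 (S e) (q1 e)) mulr0. Qed.

Lemma le_fobj x y : (forall j, 0 <= x j <= y j) -> f x <= f y.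
Proof.
move=> xy; apply: ler_sum => e _; apply: ler_wpM2l => //.
by apply: (le_lqnorm (q1 e)) => j _.
Qed.

Lemma fobjD x y : (forall j, 0 <= x j) -> (forall j, 0 <= y j) ->
  f (fun j => x j + y j) <= f x + f y.
Proof.
move=> x0 y0; rewrite /fobj -big_split; apply: ler_sum => e _ /=.
by rewrite -mulrDr ler_wpM2l//; exact: (lqnormD (S e) (q1 e)).
Qed.

Lemma eq_fobj x y : (forall j, costly j -> x j = y j) -> f x = f y.
Proof.
move=> xy; apply: eq_bigr => e _.
have [->|ce] := eqVneq (c e) 0.
  by move: (lqnorm _ _ x) (lqnorm _ _ y) => s t; rewrite !mul0r.
apply: (congr1 (fun t => c e * t)); apply: eq_lqnorm => j jS; apply: xy.
by apply/existsP; exists e; rewrite lt_neqAle eq_sym ce c0.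
Qed.

Lemma fobjZ (k : R) x : 0 <= k -> (forall j, 0 <= x j) -> f (fun j => k * x j) = k * f x.
Proof.
move=> k0 x0; rewrite /fobj mulr_sumr; apply: eq_bigr => e _.
by rewrite (lqnormZ (S e) (q1 e)) // mulrCA.
Qed.

Lemma fobj_ge_coord x e j : (forall j, 0 <= x j) -> j \in S e -> c e * x j <= f x.
Proof.
move=> x0 jS; rewrite /fobj (bigD1 e)//=.
apply: ler_wpDr; last exact: (ler_wpM2l (c0 e) (coord_le_lqnorm (q1 e) x0 jS)).
by apply: sumr_ge0 => i _; apply: mulr_ge0 => //; exact: lqnorm_ge0.
Qed.

Lemma sum_fgrad x h : \sum_j fgrad x j * h j =
  \sum_(e < r) c e *
    \sum_(j in S e) (x j / lqnorm (S e) (q e) x) `^ (q e - 1) * h j.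
Proof.
under eq_bigr do rewrite /fgrad mulr_suml.
rewrite (exchange_big_dep xpredT)//=; apply: eq_bigr => e _; rewrite mulr_sumr.
by apply: eq_bigr => j _; rewrite mulrA.
Qed.

Lemma fgrad_gt0 x j : (forall j, 0 < x j) -> costly j -> 0 < fgrad x j.
Proof.
move=> x0 /existsP[e /andP[ce jS]]; rewrite /fgrad (bigD1 e)//=.
apply: ltr_wpDr.
  by apply: sumr_ge0 => i _; apply: mulr_ge0 => //; exact: powR_ge0.
apply: mulr_gt0 => //; apply: powR_gt0; apply: divr_gt0 => //.
exact: (lqnorm_gt0 (q1 e) x0 jS).
Qed.

Lemma fobj_incr_le (rho : R) x y : (forall j, 0 < x j) ->
  (forall j, x j <= y j <= rho * x j) -> (forall e, rho `^ q e <= 2) ->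
  f y - f x <= 2 * \sum_j fgrad x j * (y j - x j).
Proof.
move=> x0 xy rho2; rewrite sum_fgrad /fobj -sumrB mulr_sumr.
apply: ler_sum => e _; rewrite -mulrBr mulrCA; apply: ler_wpM2l => //.
exact: (lqnorm_incr_le (S e) (q1 e) x0 xy).
Qed.

Lemma fpot_incr (delta : R) x y z : 0 < delta -> (forall j, 0 < x j) ->
  (forall j, x j <= y j <= 2 * x j) -> (forall j, 0 <= z j) ->
  \sum_j fgrad x j * (z j * ((y j - x j) / (x j + delta)))
  <= 2 * (fpot delta z y - fpot delta z x).
Proof.
move=> d0 x0 xy z0; rewrite sum_fgrad /fpot -sumrB mulr_sumr.
apply: ler_sum => e _; rewrite -mulrBr mulrCA; apply: ler_wpM2l => //.
exact: (lqpot_incr (S e) (q1 e)).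
Qed.

Lemma fpot_range (delta X D : R) x0 x z : 0 < delta -> 0 <= X -> 1 <= D ->
  (forall e, #|S e|%:R <= D) -> (forall j, 0 <= x0 j) ->
  (forall j, 0 <= x j <= X) -> (forall j, 0 <= z j) ->
  fpot delta z x - fpot delta z x0 <= f z * (2 * ln (1 + D * X / delta)).
Proof.
move=> d0 X0 D1 SD x00 xX z0; rewrite /fpot /fobj -sumrB mulr_suml.
apply: ler_sum => e _; rewrite -mulrBr -mulrA; apply: ler_wpM2l => //.
exact: (lqpot_range (q1 e)).
Qed.

(** The growth factor of a discrete step, small enough that every norm's gradient changes by a
    factor of at most 2 ([lqnorm_incr_le]). It is [2^(1/Q)] for a common upper bound [Q >= 1] of all
    the exponents. *)
Lemma exists_growth : exists rho : R, 1 < rho <= 2 /\ forall e, rho `^ q e <= 2.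
Proof.
pose Q : R := 1 + \sum_(e < r) q e.
have qQ e : q e <= Q.
  rewrite /Q (bigD1 e)//= addrCA lerDl addr_ge0// sumr_ge0// => i _.
  exact: le_trans ler01 (q1 i).
have Q1 : 1 <= Q.
  by rewrite lerDl sumr_ge0// => i _; exact: le_trans ler01 (q1 i).
have Q0 : 0 < Q := lt_le_trans ltr01 Q1.
have E : (2 `^ Q^-1) `^ Q = 2 :> R by rewrite -powRrM mulVf ?gt_eqF// powRr1.
exists (2 `^ Q^-1); have rho1 : 1 < 2 `^ Q^-1 :> R.
  rewrite -{1}(powRr0 (2 : R)) ltNge; apply/negP => H.
  have := ge0_ler_powR (ltW Q0) _ _ H; rewrite !nnegrE !powR_ge0 E powRr0 powR1.
  by move=> /(_ isT isT); rewrite lern1.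
split.
  rewrite rho1/= -[leRHS]powRr1//; apply: ler_powR; first by rewrite ler1n.
  by rewrite invf_le1.
by move=> e; rewrite -{2}E; apply: ler_powR => //; exact: ltW.
Qed.

End Objective.

(** * The discretized flow on a single violated row *)

Section Step.
Variables (R : realType) (n r : nat) (c : 'I_r -> R) (S : 'I_r -> {set 'I_n}).
Variable q : 'I_r -> R.
Hypotheses (c0 : forall e, 0 <= c e) (q1 : forall e, 1 <= q e).
Implicit Types (a x y z : 'I_n -> R) (delta : R).
Local Notation f := (fobj c S q).
Local Notation costly := (costly c S).

Definition suppn a : nat := #|[pred j | 0 < a j]|.

(* The cost of the increment is paid by the potential, for every possible optimum [z]
   and every offset [delta] below [1 / (d a_max)]; neither is known to the algorithm. *)
Definition increment a x y : Prop :=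
  [/\ forall j, x j <= y j,
      forall j, y j = x j \/ (0 < a j /\ a j * y j <= 2) &
      forall delta z, 0 < delta -> (forall j, 0 <= z j) -> 1 <= row_val a z ->
        (forall j, a j * delta * (suppn a)%:R <= 1) ->
        f y - f x <= 8 * (fpot c S q delta z y - fpot c S q delta z x)].

Lemma increment_refl a x : increment a x x.
Proof. by split=> [//|j|delta z *]; [left|rewrite !subrr mulr0]. Qed.

Lemma increment_trans a x y z : increment a x y -> increment a y z -> increment a x z.
Proof.
move=> [xy Exy Pxy] [yz Eyz Pyz]; split=> [j|j|delta w d0 w0 aw ad].
- exact: le_trans (xy j) (yz j).
- by case: (Eyz j) => [->|]; [exact: Exy|right].
- have := lerD (Pyz delta w d0 w0 aw ad) (Pxy delta w d0 w0 aw ad).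
  move: (f x) (f y) (f z) => s t u.
  move: (fpot _ _ _ _ _ x) (fpot _ _ _ _ _ y) (fpot _ _ _ _ _ z) => s' t' u'.
  lra.
Qed.

Definition costly_row a : Prop :=
  (forall j, 0 <= a j) /\ (exists j, 0 < a j) /\ (forall j, 0 < a j -> costly j).

Lemma row_valE a x : (forall j, 0 <= a j) ->
  row_val a x = \sum_(j | 0 < a j) a j * x j.
Proof.
move=> a0; rewrite /row_val (bigID (fun j => 0 < a j))/= [X in _ + X]big1 ?addr0//.
move=> j; rewrite -leNgt => aj; suff -> : a j = 0 by rewrite mul0r.
by apply/eqP; rewrite eq_le aj a0.
Qed.

Lemma suppn_gt0 a : (exists j, 0 < a j) -> 0 < (suppn a)%:R :> R.
Proof. by move=> [j aj]; rewrite ltr0n; apply/card_gt0P; exists j. Qed.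

Lemma sum_suppn a : \sum_(j | 0 < a j) (suppn a)%:R^-1 = (suppn a)%:R / (suppn a)%:R :> R.
Proof. by rewrite sumr_const mulr_natl. Qed.

(* Discretized flow [dx_j = (a_j x_j + 1/d_a) / (grad f)_j dt], run until some
   coordinate has grown by the factor [rho]. *)
Lemma micro_step (rho : R) a x : 1 < rho <= 2 -> (forall e, rho `^ q e <= 2) ->
  costly_row a -> (forall j, 0 < x j) -> row_val a x < 1 ->
  exists y, [/\ increment a x y, forall j, 0 < y j &
    exists2 j, 0 < a j & y j = rho * x j].
Proof.
move=> /andP[rho1 rho2] rhoq [a0 [aP aC]] x0 ax.
have D0 := suppn_gt0 aP; set D : R := (suppn a)%:R in D0 *.
pose g := fgrad c S q x.
have g0 j : 0 < a j -> 0 < g j by move=> /aC; exact: fgrad_gt0.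
pose h j : R := if 0 < a j then (a j * x j + D^-1) / g j else 0.
have D0' : 0 < D^-1 by rewrite invr_gt0.
have h0 j : 0 < a j -> 0 < h j.
  move=> aj; rewrite /h aj divr_gt0 ?g0//; apply: addr_gt0 => //.
  exact: mulr_gt0.
have h00 j : 0 <= h j.
  by have [/h0/ltW//|aj] := boolP (0 < a j); rewrite /h (negbTE aj).
have rm0 : 0 < rho - 1 by rewrite subr_gt0.
pose F j : R := (rho - 1) * x j / h j.
have [i ai] := aP.
(* The coordinate that first reaches the factor [rho] on the ray [x + t h]. Stopping at its time
   [F j0] keeps all other coordinates within that factor. *)
pose j0 : 'I_n := [arg min_(j < i | 0 < a j) F j]%O.
have [aj0 j0min] : 0 < a j0 /\ forall j, 0 < a j -> F j0 <= F j.
  by rewrite /j0; case: arg_minP.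
pose t := F j0.
have t0 : 0 < t by apply: divr_gt0; [exact: mulr_gt0|exact: h0].
pose y j := x j + t * h j.
have xy j : x j <= y j by rewrite lerDl mulr_ge0// ltW.
have yx j : y j <= rho * x j.
  have [aj|aj] := boolP (0 < a j); last first.
    by rewrite /y /h (negbTE aj) mulr0 addr0 ler_peMl ?ltW.
  have := j0min j aj; rewrite -/t /F ler_pdivlMr ?h0// => H.
  by rewrite /y addrC -lerBrDr; apply: le_trans H _; rewrite mulrBl mul1r.
have y2 j : y j <= 2 * x j.
  by apply: le_trans (yx j) _; rewrite ler_wpM2r// ltW.
have yj0 : y j0 = rho * x j0.
  by rewrite /y /t /F divfK ?gt_eqF ?h0// mulrBl mul1r addrC subrK.
exists y; split; last by exists j0.
  split=> // [j|delta z d0 z0 az ad].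
    have [aj|aj] := boolP (0 < a j); last first.
      by left; rewrite /y /h (negbTE aj) mulr0 addr0.
    right; split=> //.
    apply: (@le_trans _ _ (a j * (2 * x j))); first by rewrite ler_wpM2l.
    rewrite mulrCA -[leRHS]mulr1 ler_wpM2l//; apply: le_trans (ltW ax).
    rewrite row_valE// (bigD1 j)//= lerDl sumr_ge0// => k _.
    by rewrite mulr_ge0// ltW.
  have yxh j : y j - x j = t * h j by rewrite /y addrC addKr.
  (* The gradient cancels the denominator of [h]: the first-order cost is
     [t * (row_val a x + 1) <= 2 * t], and [fobj_incr_le] doubles it. *)
  have cost : f y - f x <= 4 * t.
    apply: le_trans (fobj_incr_le S c0 q1 x0 _ rhoq) _.
      by move=> j; rewrite xy yx.
    rewrite -/g (bigID (fun j => 0 < a j))/= [X in _ + X]big1 ?addr0; last first.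
      by move=> j aj; rewrite yxh /h (negbTE aj) !mulr0.
    rewrite (eq_bigr (fun j => t * (a j * x j + D^-1))); last first.
      move=> j aj; rewrite yxh /h aj mulrCA; congr (_ * _).
      by rewrite mulrCA mulfV ?mulr1 ?gt_eqF ?g0.
    rewrite -mulr_sumr big_split/= -row_valE// sum_suppn -/D mulfV ?gt_eqF//.
    move: (row_val a x) ax => s s1; nra.
  (* Coordinatewise this is [a j <= (a j * x j + D^-1) / (x j + delta)], which amounts to
     [a j * delta * D <= 1]. With [cost] it yields the constant 8. *)
  have gain : t <= 2 * (fpot c S q delta z y - fpot c S q delta z x).
    apply: le_trans (fpot_incr S c0 q1 d0 x0 _ z0); last first.
      by move=> j; rewrite xy y2.
    apply: (@le_trans _ _ (t * row_val a z)); first by rewrite ler_peMr// ltW.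
    rewrite row_valE// mulr_sumr -/g [leRHS](bigID (fun j => 0 < a j))/=.
    rewrite [X in _ <= _ + X]big1 ?addr0; last first.
      by move=> j aj; rewrite yxh /h (negbTE aj) !(mulr0, mul0r).
    apply: ler_sum => j aj; have xd : 0 < x j + delta by rewrite addr_gt0.
    have -> : g j * (z j * ((y j - x j) / (x j + delta))) =
        t * z j * ((a j * x j + D^-1) / (x j + delta)).
      by rewrite yxh /h aj; field; rewrite (gt_eqF xd) (gt_eqF (g0 j aj)) (gt_eqF D0).
    rewrite [a j * z j]mulrC [leLHS]mulrA; apply: ler_wpM2l.
      by rewrite mulr_ge0// ltW.
    rewrite ler_pdivlMr// mulrDr lerD2l -[leRHS]mul1r ler_pdivlMr//.
  move: (f y - f x) (fpot _ _ _ _ _ y - _) cost gain => s u; lra.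
by move=> j; apply: lt_le_trans (xy j).
Qed.

(** Termination: each [micro_step] multiplies the product of the [a j * x j] over the support of [a]
    by at least [rho], while on a violated row every factor, hence the product, is below 1. So [K]
    steps suffice. *)
Lemma row_step a x : costly_row a -> (forall j, 0 < x j) ->
  exists2 y, increment a x y & 1 <= row_val a y.
Proof.
move=> aC x0; have [rho [rho12 rhoq]] := exists_growth q1.
have /andP[rho1 rho2] := rho12.
have [a0 [aP _]] := aC.
have [K HK] : exists K : nat, 1 <= rho ^+ K * \prod_(j | 0 < a j) (a j * x j).
  pose P := \prod_(j | 0 < a j) (a j * x j).
  have P0 : 0 < P by apply: prodr_gt0 => j aj; exact: mulr_gt0.
  have rm0 : 0 < rho - 1 by rewrite subr_gt0.
  (* Bernoulli: [rho ^+ K >= K * (rho - 1)]. *)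
  exists (Num.bound (P^-1 / (rho - 1))); rewrite -ler_pdivrMr// mul1r.
  set K := Num.bound _; have KP : P^-1 / (rho - 1) < K%:R.
    by apply: archi_boundP; apply: divr_ge0; rewrite ?invr_ge0; exact: ltW.
  rewrite ltr_pdivrMr// in KP; apply: le_trans (ltW KP) _.
  elim: K {KP} => [|k IH]; first by rewrite mul0r ler01.
  have : 1 <= rho ^+ k by rewrite exprn_ege1// ltW.
  rewrite exprS -natr1; move: (rho ^+ k) IH => s; move: (k%:R : R) => m; nra.
elim: K x x0 HK => [|K IH] x x0 HK.
  exists x; first exact: increment_refl.
  rewrite leNgt; apply/negP => ax; move: HK; rewrite expr0 mul1r leNgt => /negP; apply.
  have lt1 j : 0 < a j -> a j * x j < 1.
    move=> aj; apply: le_lt_trans ax; rewrite row_valE// (bigD1 j)//= lerDl.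
    by apply: sumr_ge0 => k _; rewrite mulr_ge0// ltW.
  have [i ai] := aP; rewrite (bigD1 i)//=.
  apply: (@le_lt_trans _ _ (a i * x i)); last exact: lt1.
  rewrite ler_piMr ?mulr_ge0 ?(ltW (x0 _))//; apply: prodr_ile1 => j /andP[aj _].
  by rewrite mulr_ge0 ?(ltW (x0 _))//= ltW// lt1.
have [ax|ax] := leP 1 (row_val a x); first by exists x; first exact: increment_refl.
have [y [xy y0 [j aj yj]]] := micro_step rho12 rhoq aC x0 ax.
have [z yz az] : exists2 z, increment a y z & 1 <= row_val a z.
  apply: IH => //; apply: le_trans HK _; rewrite exprSr -mulrA.
  rewrite ler_wpM2l ?exprn_ge0 ?(le_trans ler01 (ltW rho1))//.
  rewrite (bigD1 j)//= [leRHS](bigD1 j)//= yj !mulrA [rho * _]mulrC.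
  rewrite ler_wpM2l ?mulr_ge0 ?(le_trans ler01 (ltW rho1)) ?(ltW (x0 _))//.
  apply: ler_prod => i _; rewrite mulr_ge0 ?(ltW (x0 _))//= ler_wpM2l//.
  by case: xy.
by exists z => //; exact: increment_trans xy yz.
Qed.

End Step.

(** * Processing the rows in order, and the resulting competitive ratio *)

Lemma ln_quadratic_le (R : realType) (D k : R) : 1 <= D <= k ->
  ln (1 + 2 * D * k) <= 2 + 2 * ln k.
Proof.
move=> /andP[D1 Dk]; have D0 := lt_le_trans ltr01 D1; have k0 := lt_le_trans D0 Dk.
have -> : 2 + 2 * ln k = 2 + ln (k ^+ 2) by rewrite lnXn// mulr2n mulrDl mul1r.
(* Here [1 + 2 * D * k <= 3 * k ^+ 2], and [ln 3 <= 2]. *)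
apply: (@le_trans _ _ (ln (3 * k ^+ 2))).
  rewrite ler_ln ?posrE.
  - have : 1 <= k * k by rewrite mulr_ege1 ?(le_trans D1 Dk).
    have := ler_wpM2r (ltW k0) Dk; rewrite expr2 -mulrA.
    move: (D * k) (k * k) => s t; lra.
  - by apply: ltr_wpDr => //; apply: mulr_ge0 (ltW k0); apply: mulr_ge0 (ltW D0).
  - by apply: mulr_gt0 => //; exact: exprn_gt0.
rewrite lnM ?posrE ?exprn_gt0// lerD2r.
have := @le_ln1Dx R 2; rewrite (_ : 1 + 2 = 3 :> R); last by ring.
by apply; lra.
Qed.

Section Core.
Variables (R : realType) (n r : nat) (c : 'I_r -> R) (S : 'I_r -> {set 'I_n}).
Variable q : 'I_r -> R.
Hypotheses (c0 : forall e, 0 <= c e) (q1 : forall e, 1 <= q e).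
Implicit Types (a x y z : 'I_n -> R) (rows : seq ('I_n -> R)).
Local Notation f := (fobj c S q).
Local Notation costly := (costly c S).
Local Notation costly_row := (costly_row c S).

(** A choice among the vectors provided by [row_step]; it depends only on the objective, the current
    vector and the new row. *)
Definition next_row x a : 'I_n -> R :=
  xget x [set y | increment c S q a x y /\ 1 <= row_val a y].

Lemma next_rowP x a : costly_row a -> (forall j, 0 < x j) ->
  increment c S q a x (next_row x a) /\ 1 <= row_val a (next_row x a).
Proof.
move=> aC x0; have [y xy ay] := row_step c0 q1 aC x0.
by rewrite /next_row; case: xgetP => [_ -> //|/(_ y)]; case; split.
Qed.

(* [1 <= (\sum \sum a_j / c_e) * f z] for every [z] covering [a]. *)
Definition start a : R :=
  (1 + \sum_j a j +
   (\sum_(j | 0 < a j) \sum_(e < r | (0 < c e) && (j \in S e)) a j / c e) * f (fun=> 1))^-1.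

(** The flow needs a positive starting point. In the denominator of [start], the sum of the [a j]
    keeps [a j * start a] below 1, and the other term makes the start no dearer than any [z]
    covering [a]. *)
Lemma startP a : costly_row a -> [/\ 0 < start a, forall j, a j * start a <= 1 &
  forall z, (forall j, 0 <= z j) -> 1 <= row_val a z -> f (fun=> start a) <= f z].
Proof.
move=> [a0 [aP aC]]; rewrite /start; set M := \sum_(j | _) _.
have M0 : 0 <= M.
  by apply: sumr_ge0 => j _; apply: sumr_ge0 => e _; apply: divr_ge0.
have F0 : 0 <= f (fun=> 1) by apply: fobj_ge0.
have s0 : 0 <= \sum_j a j by apply: sumr_ge0.
set T := (1 + _ + _).
have T1 : 1 + \sum_j a j <= T by rewrite lerDl mulr_ge0.
have TM : M * f (fun=> 1) <= T by rewrite lerDr addr_ge0.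
have T0 : 0 < T by apply: lt_le_trans T1; rewrite ltr_wpDr.
have Ti0 : 0 < T^-1 by rewrite invr_gt0.
split; [exact: Ti0|move=> j|move=> z z0 az].
  rewrite ler_pdivrMr// mul1r; apply: le_trans T1.
  by rewrite (bigD1 j)//= addrCA lerDl addr_ge0// sumr_ge0.
have Mz : 1 <= M * f z.
  apply: le_trans az _; rewrite row_valE// mulr_suml; apply: ler_sum => j aj.
  have /existsP[e /andP[ce jS]] := aC j aj.
  rewrite mulr_suml (bigD1 e)/=; last by rewrite ce.
  apply: ler_wpDr.
    apply: sumr_ge0 => i _; apply: mulr_ge0; first exact: divr_ge0.
    exact: fobj_ge0.
  rewrite -mulrA; apply: ler_wpM2l => //.
  by rewrite ler_pdivlMl; [exact: (fobj_ge_coord c0 q1 z0 jS)|exact: ce].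
have Mp : 0 < M.
  by rewrite lt_neqAle M0 andbT eq_sym; apply: contraTneq Mz => ->; rewrite mul0r -ltNge.
have -> : f (fun=> T^-1) = T^-1 * f (fun=> 1).
  rewrite -(@fobjZ R n r c S q q1 T^-1 (fun=> 1) (ltW Ti0) (fun=> ler01)).
  by apply: (eq_fobj q c0) => j _; rewrite mulr1.
rewrite -(ler_pM2l Mp); apply: le_trans Mz.
by rewrite mulrCA ler_pdivrMl// mulr1.
Qed.

(** The potential bounds telescope over the rows. The upper bound [X] persists because a coordinate
    changes only to a value with [a j * y j <= 2]. *)
Lemma foldl_next_row x rows : (forall j, 0 < x j) -> {in rows, forall a, costly_row a} ->
  let y := foldl next_row x rows in
  [/\ forall j, x j <= y j, {in rows, forall a, 1 <= row_val a y},
      forall X, (forall j, x j <= X) ->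
        {in rows, forall a, forall j, 0 < a j -> 2 <= a j * X} ->
        forall j, y j <= X &
      forall delta z, 0 < delta -> (forall j, 0 <= z j) ->
        {in rows, forall a, 1 <= row_val a z} ->
        {in rows, forall a, forall j, a j * delta * (suppn a)%:R <= 1} ->
        f y - f x <= 8 * (fpot c S q delta z y - fpot c S q delta z x)].
Proof.
elim: rows x => [|a s IH] x x0 rC /=.
  split=> [//|//|X xX _ //|delta z *]; first by rewrite !subrr mulr0.
have aC : costly_row a by apply: rC; rewrite mem_head.
have [[xy Exy Pxy] ay] := next_rowP aC x0; set y := next_row x a in xy Exy Pxy ay *.
have y0 j : 0 < y j := lt_le_trans (x0 j) (xy j).
have sC : {in s, forall b, costly_row b} by move=> b bs; apply: rC; rewrite inE bs orbT.
have [yw sw sX sP] := IH y y0 sC; set w := foldl _ _ _ in yw sw sX sP *.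
split=> [j|b|X xX rX|delta z d0 z0 rz rd].
- exact: le_trans (xy j) (yw j).
- rewrite inE => /predU1P[->|]; last exact: sw.
  apply: le_trans ay _; apply: ler_sum => j _; apply: ler_wpM2l => //.
  by case: aC.
- apply: sX => [j|b bs]; last by apply: rX; rewrite inE bs orbT.
  case: (Exy j) => [->//|[aj aj2]].
  rewrite -(ler_pM2l aj); apply: le_trans aj2 _.
  by apply: rX => //; rewrite mem_head.
- have H1 : f y - f x <= 8 * (fpot c S q delta z y - fpot c S q delta z x).
    by apply: Pxy => // [|j]; [apply: rz|apply: rd]; rewrite mem_head.
  have H2 : f w - f y <= 8 * (fpot c S q delta z w - fpot c S q delta z y).
    by apply: sP => // b bs; [apply: rz|apply: rd]; rewrite inE bs orbT.
  move: (lerD H2 H1); rewrite -mulrDr.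
  move: (f x) (f y) (f w) {H1 H2} => s1 t1 u1.
  move: (fpot _ _ _ _ _ x) (fpot _ _ _ _ _ y) (fpot _ _ _ _ _ w) => s' t' u'.
  lra.
Qed.

(** The starting point uses only the first row, so later arrivals leave it unchanged; before any row
    the output is zero. *)
Definition core rows : 'I_n -> R :=
  if rows is a :: _ then foldl next_row (fun=> start a) rows else fun=> 0.

Lemma core_cover rows : {in rows, forall a, costly_row a} ->
  (forall j, 0 <= core rows j) /\ {in rows, forall a, 1 <= row_val a (core rows)}.
Proof.
case: rows => [|a s] rC; first by split.
have [s0 _ _] := startP (rC a (mem_head _ _)).
have [xy ay _ _] := foldl_next_row (fun=> s0) rC.
by split=> // j; apply: le_trans (xy j); exact: ltW.
Qed.

Lemma core_rcons rows a : {in rows, forall b, costly_row b} -> costly_row a ->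
  forall j, core rows j <= core (rcons rows a) j.
Proof.
case: rows => [|b s] rC aC j.
  have C1 : {in [:: a], forall b, costly_row b} by move=> b; rewrite inE => /eqP->.
  by case: (core_cover C1).
have [s0 _ _] := startP (rC b (mem_head _ _)).
have [xy _ _ _] := foldl_next_row (fun=> s0) rC.
rewrite /core rcons_cons -rcons_cons foldl_rcons.
have y0 i : 0 < foldl next_row (fun=> start b) (b :: s) i := lt_le_trans s0 (xy i).
by have [[+ _ _] _] := next_rowP aC y0; apply.
Qed.

(** The increase costs at most [8 * 2 * (2 + 2 * ln k) = 32 * (1 + ln k)] times [f z], and the start
    at most one more [f z], whence 33. *)
Lemma core_competitive rows (amn amx D : R) : {in rows, forall a, costly_row a} ->
  0 < amn <= amx -> 1 <= D ->
  {in rows, forall a, forall j, 0 < a j -> amn <= a j <= amx} ->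
  {in rows, forall a, (suppn a)%:R <= D} -> (forall e, #|S e|%:R <= D) ->
  forall z, (forall j, 0 <= z j) -> {in rows, forall a, 1 <= row_val a z} ->
  f (core rows) <= 33 * (1 + ln (amx / amn * D)) * f z.
Proof.
move=> rC /andP[m0 mM] D1 rA rD SD z z0 rz.
have M0 := lt_le_trans m0 mM; have D0 := lt_le_trans ltr01 D1.
have k1 : 1 <= amx / amn by rewrite ler_pdivlMr// mul1r.
set k := amx / amn * D.
have Dk : D <= k by rewrite /k ler_peMl// ltW.
have k0 : 0 < k := lt_le_trans D0 Dk.
have lk : 0 <= ln k by rewrite ln_ge0// (le_trans D1).
have fz := fobj_ge0 S q c0 z.
case: rows rC rA rD rz => [|a s] rC rA rD rz.
  by rewrite (fobj0 c S q1) mulr_ge0// mulr_ge0// addr_ge0.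
have aC := rC a (mem_head _ _).
have [s0 as1 sf] := startP aC.
have [xy _ yX yP] := foldl_next_row (fun=> s0) rC.
rewrite /core; set y := foldl _ _ _ in xy yX yP *.
(* [delta] meets the condition [a j * delta * suppn a <= 1] for all rows, and [X] bounds all
   coordinates, since [a j * y j <= 2] with [a j >= amn]. *)
pose delta := (D * amx)^-1; pose X := 2 / amn.
have d0 : 0 < delta by rewrite invr_gt0 mulr_gt0.
have X0 : 0 <= X by rewrite divr_ge0// ltW.
have {yX} yX j : y j <= X.
  apply: yX => [_|b bs i bi]; last first.
    by rewrite /X mulrCA ler_peMr// ler_pdivlMr// mul1r; case/andP: (rA b bs i bi).
  have [_ [[i ai] _]] := aC; have /andP[mi _] := rA a (mem_head _ _) i ai.
  rewrite /X ler_pdivlMr//; apply: (@le_trans _ _ 1); last by rewrite ler1n.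
  apply: le_trans (as1 i); rewrite mulrC; apply: ler_wpM2r => //; exact: ltW.
have {yP} yP : f y - f (fun=> start a) <=
    8 * (fpot c S q delta z y - fpot c S q delta z (fun=> start a)).
  apply: yP => // b bs j; have [b0 [bP _]] := rC b bs.
  have [bj|] := boolP (0 < b j); last first.
    rewrite -leNgt => bj; suff -> : b j = 0 by rewrite !mul0r.
    by apply/eqP; rewrite eq_le bj b0.
  rewrite /delta mulrAC ler_pdivrMr ?mulr_gt0// mul1r mulrC.
  by apply: ler_pM => //; [exact: rD|case/andP: (rA b bs j bj)].
have P := @fpot_range R n r c S q c0 q1 delta X D (fun=> start a) y z d0 X0 D1 SD.
have {}P := P (fun=> ltW s0) _ z0.
have {}P : fpot c S q delta z y - fpot c S q delta z (fun=> start a) <=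
    f z * (2 * ln (1 + D * X / delta)).
  by apply: P => j; rewrite yX (le_trans (ltW s0) (xy j)).
have L : ln (1 + D * X / delta) <= 2 + 2 * ln k.
  have -> : D * X / delta = 2 * D * k.
    by rewrite /delta /X /k; field; rewrite !gt_eqF.
  by apply: ln_quadratic_le; rewrite D1.
have := sf z z0 (rz a (mem_head _ _)); move: yP P.
move: (fpot _ _ _ _ _ y - _) => pd; move: (f y) (f (fun=> start a)) => fy fs.
move: (ln (1 + _)) L => l L yP P sz.
have : f z * (2 * l) <= f z * (2 * (2 + 2 * ln k)).
  by apply: ler_wpM2l => //; rewrite ler_pM2l.
have : 0 <= f z * ln k by apply: mulr_ge0.
clear -yP P sz; move: yP P sz; move: (f z) (ln k) => u v; lra.
Qed.

End Core.

(** * Coordinates of zero cost, and comparison with [OPT] *)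

Section Online.
Variables (R : realType) (n r : nat) (c : 'I_r -> R) (S : 'I_r -> {set 'I_n}).
Variable q : 'I_r -> R.
Hypotheses (c0 : forall e, 0 <= c e) (q1 : forall e, 1 <= q e).
Implicit Types (a x y z : 'I_n -> R) (rows : seq ('I_n -> R)).
Local Notation f := (fobj c S q).
Local Notation costly := (costly c S).

Definition charged a : bool := [forall j, (0 < a j) ==> costly j].

(* Coordinates of zero cost are raised at once: [(a j)^-1] is [0] when [a j = 0]. *)
Definition online rows : 'I_n -> R := fun j =>
  if costly j then core c S q (seq.filter charged rows) j else \sum_(a <- rows) (a j)^-1.

Lemma charged_costly_row a : valid_row a -> charged a -> costly_row c S a.
Proof. by move=> [a0 aP] /forallP aC; split=> //; split=> // j; exact/implyP. Qed.

Lemma filter_costly_rows rows : {in rows, forall a, valid_row a} ->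
  {in seq.filter charged rows, forall a, costly_row c S a}.
Proof.
by move=> rV a; rewrite mem_filter => /andP[aC /rV aV]; exact: charged_costly_row.
Qed.

Lemma online_ge0 rows : {in rows, forall a, valid_row a} -> forall j, 0 <= online rows j.
Proof.
move=> rV j; rewrite /online; case: ifP => _.
  by case: (core_cover c0 q1 (filter_costly_rows rV)).
by rewrite big_seq; apply: sumr_ge0 => a /rV[a0 _]; rewrite invr_ge0.
Qed.

(** A row supported on costly coordinates is handled by [core]; any other row has a free coordinate
    [j], whose value includes [(a j)^-1] and covers the row alone. *)
Lemma online_cover rows : {in rows, forall a, valid_row a} ->
  {in rows, forall a, 1 <= row_val a (online rows)}.
Proof.
move=> rV a ar; have [a0 aP] := rV a ar.
have o0 := online_ge0 rV.
have [aC|] := boolP (charged a).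
  have -> : row_val a (online rows) = row_val a (core c S q (seq.filter charged rows)).
    rewrite !row_valE//; apply: eq_bigr => j aj; rewrite /online.
    by have /forallP/(_ j) := aC; rewrite aj => /= ->.
  have [_] := core_cover c0 q1 (filter_costly_rows rV).
  by apply; rewrite mem_filter aC.
rewrite negb_forall => /existsP[j]; rewrite negb_imply => /andP[aj jC].
rewrite /row_val (bigD1 j)//= ler_wpDr//.
  by apply: sumr_ge0 => i _; exact: mulr_ge0.
rewrite /online (negbTE jC) (big_rem a ar)/= mulrDr mulfV ?gt_eqF//.
rewrite lerDl mulr_ge0// big_seq; apply: sumr_ge0 => b /mem_rem /rV[b0 _].
by rewrite invr_ge0.
Qed.

Lemma online_rcons rows a : {in rows, forall b, valid_row b} -> valid_row a ->
  forall j, online rows j <= online (rcons rows a) j.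
Proof.
move=> rV aV j; rewrite /online; case: ifP => _.
  rewrite filter_rcons; case: ifP => // aC.
  apply: (core_rcons c0 q1); first exact: filter_costly_rows.
  exact: charged_costly_row.
by rewrite -cats1 big_cat big_seq1 lerDl invr_ge0; case: aV.
Qed.

Lemma amax_ge rows a j : a \in rows -> a j <= amax rows.
Proof.
move=> ar; rewrite /amax; apply: bigmax_sup_seq ar _ _ => //.
exact: le_bigmax.
Qed.

Lemma amin_le rows a j : a \in rows -> a j != 0 -> amin rows <= a j.
Proof.
move=> ar aj; rewrite /amin; apply: bigmin_inf_seq ar _ _ => //.
exact: bigmin_le_cond.
Qed.

Lemma amin_gt0 rows : {in rows, forall a, valid_row a} -> rows != [::] -> 0 < amin rows.
Proof.
move=> rV rn; have M0 : 0 < amax rows.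
  case: rows rn rV => // a s _ rV; have [_ [j aj]] := rV a (mem_head _ _).
  by apply: lt_le_trans aj _; apply: amax_ge; exact: mem_head.
rewrite /amin big_seq; apply: lt_bigmin => // a /rV[a0 _]; apply: lt_bigmin => // j aj.
by rewrite lt_neqAle eq_sym aj a0.
Qed.

Lemma amin_le_amax rows : amin rows <= amax rows.
Proof. exact: bigmin_le_id. Qed.

Lemma suppn_le_dpar rows a : {in rows, forall a, valid_row a} -> a \in rows ->
  (suppn a <= dpar S rows)%N.
Proof.
move=> rV ar; apply: leq_trans (leq_maxl _ _); have [a0 _] := rV a ar.
apply: leq_trans (leq_bigmax_seq _ ar _) => //.
rewrite /suppn; apply: subset_leq_card; apply/fintype.subsetP => j; rewrite inE => aj.
by rewrite inE/= gt_eqF.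
Qed.

Lemma card_le_dpar rows e : (#|S e| <= dpar S rows)%N.
Proof. by apply: leq_trans (leq_maxr _ _); exact: leq_bigmax. Qed.

Lemma dpar_gt0 rows : {in rows, forall a, valid_row a} -> rows != [::] ->
  (0 < dpar S rows)%N.
Proof.
case: rows => // a s rV _; have ar : a \in a :: s := mem_head _ _.
apply: leq_trans (suppn_le_dpar rV ar); rewrite -(ltr0n R); apply: suppn_gt0.
by case: (rV a ar).
Qed.

Lemma kappa_dpar_ge1 rows : {in rows, forall a, valid_row a} -> rows != [::] ->
  1 <= kappa rows * (dpar S rows)%:R.
Proof.
move=> rV rn; rewrite mulr_ege1 ?ler1n ?dpar_gt0//.
by rewrite /kappa ler_pdivlMr ?amin_gt0// mul1r amin_le_amax.
Qed.

Lemma online_nil : online [::] = fun=> 0.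
Proof. by apply/funext => j; rewrite /online/= big_nil; case: ifP. Qed.

(** A lower bound passes to the infimum only over a nonempty set; the output of [online] is the
    feasible witness. *)
Lemma OPT_ge0 rows : {in rows, forall a, valid_row a} -> 0 <= OPT c S q rows.
Proof.
move=> rV; apply: lb_le_inf.
  exists (f (online rows)), (online rows) => //; split; first exact: online_ge0.
  by apply/allP; exact: online_cover.
by move=> _ [z _ <-]; exact: fobj_ge0.
Qed.

Lemma online_competitive rows : {in rows, forall a, valid_row a} ->
  f (online rows) <= 33 * (1 + ln (kappa rows * (dpar S rows)%:R)) * OPT c S q rows.
Proof.
move=> rV; have [->|rn] := eqVneq rows [::].
  rewrite online_nil (fobj0 c S q1) mulr_ge0 ?OPT_ge0//.
  (* Without rows [kappa] is 0 and its logarithm is 0 by convention. *)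
  by rewrite /kappa /amax !big_nil !mul0r ln0// addr0 mulr1.
have k1 := kappa_dpar_ge1 rV rn; have lk := ln_ge0 k1.
have m0 := amin_gt0 rV rn.
have C0 : 0 < 33 * (1 + ln (kappa rows * (dpar S rows)%:R)).
  by rewrite mulr_gt0// ltr_wpDr.
rewrite -ler_pdivrMl//; apply: lb_le_inf.
  exists (f (online rows)), (online rows) => //; split; first exact: online_ge0.
  by apply/allP; exact: online_cover.
move=> _ [z [z0 /allP zr] <-]; rewrite ler_pdivrMl//.
have -> : f (online rows) = f (core c S q (seq.filter charged rows)).
  by apply: (eq_fobj q c0) => j jC; rewrite /online jC.
apply: (core_competitive c0 q1 (filter_costly_rows rV)) => //.
- by rewrite m0 amin_le_amax.
- by rewrite ler1n dpar_gt0.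
- move=> a; rewrite mem_filter => /andP[_ ar] j aj.
  by rewrite amax_ge// amin_le// gt_eqF.
- by move=> a; rewrite mem_filter => /andP[_ ar]; rewrite ler_nat suppn_le_dpar.
- by move=> e; rewrite ler_nat card_le_dpar.
- by move=> a; rewrite mem_filter => /andP[_ /zr].
Qed.

End Online.

(** * Switching between an abstract online algorithm and the advice *)

Section FollowAdvice.
Variables (R : realType) (n : nat) (F : ('I_n -> R) -> R).
Variables (alg : seq ('I_n -> R) -> 'I_n -> R) (x' : 'I_n -> R).
Implicit Types (a x y : 'I_n -> R) (rows : seq ('I_n -> R)).
Local Notation valid rows := {in rows, forall a : 'I_n -> R, valid_row a}.
Hypothesis F_mono : forall x y, (forall j, 0 <= x j <= y j) -> F x <= F y.
Hypothesis F_subadd : forall x y, (forall j, 0 <= x j) -> (forall j, 0 <= y j) ->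
  F (fun j => x j + y j) <= F x + F y.
Hypothesis x'_ge0 : forall j, 0 <= x' j.
Hypothesis alg_nil : F (alg [::]) <= F x'.
Hypothesis alg_ge0 : forall rows, valid rows -> forall j, 0 <= alg rows j.
Hypothesis alg_cover : forall rows, valid rows ->
  {in rows, forall a, 1 <= row_val a (alg rows)}.
Hypothesis alg_rcons : forall rows a, valid rows -> valid_row a ->
  forall j, alg rows j <= alg (rcons rows a) j.

(** The output on the longest prefix no dearer than the advice. Prefixes lose their last row first,
    so the recursion runs on the reversed list. *)
Fixpoint last_cheap_rev rows : 'I_n -> R :=
  if rows is _ :: s then
    if F (alg (rev rows)) <= F x' then alg (rev rows) else last_cheap_rev s
  else alg [::].

Definition last_cheap rows := last_cheap_rev (rev rows).

Lemma last_cheap_rcons rows a : last_cheap (rcons rows a) =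
  if F (alg (rcons rows a)) <= F x' then alg (rcons rows a) else last_cheap rows.
Proof. by rewrite /last_cheap rev_rcons/= rev_cons revK. Qed.

Definition advised rows : 'I_n -> R :=
  if F (alg rows) <= F x' then alg rows
  else fun j => x' j + (if all (fun a => 1 <= row_val a x') rows
                        then last_cheap rows else alg rows) j.

Lemma valid_rconsP rows a : valid (rcons rows a) -> valid rows /\ valid_row a.
Proof.
move=> rV; split=> [b br|]; apply: rV; rewrite mem_rcons inE ?eqxx//.
by rewrite br orbT.
Qed.

Lemma last_cheapP rows : valid rows ->
  [/\ forall j, 0 <= last_cheap rows j <= alg rows j, F (last_cheap rows) <= F x' &
      F (alg rows) <= F x' -> last_cheap rows = alg rows].
Proof.
elim/last_ind: rows => [_|rows a IH raV].
  by split=> // j; rewrite alg_ge0//=.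
have [rV aV] := valid_rconsP raV; have [lc cheap _] := IH rV.
rewrite last_cheap_rcons; have [le|gt] := leP (F (alg (rcons rows a))) (F x').
  by split=> // j; rewrite alg_ge0/=.
split=> // j; have /andP[-> lj] := lc j.
by apply: le_trans lj _; exact: alg_rcons.
Qed.

Lemma advised_ge0 rows : valid rows -> forall j, 0 <= advised rows j.
Proof.
move=> rV j; rewrite /advised; case: ifP => _; first exact: alg_ge0.
apply: addr_ge0 => //; case: ifP => _; last exact: alg_ge0.
by have [/(_ j)/andP[]] := last_cheapP rV.
Qed.

Lemma advised_cover rows : valid rows -> {in rows, forall a, 1 <= row_val a (advised rows)}.
Proof.
move=> rV a ar; have [a0 _] := rV a ar; rewrite /advised; case: ifP => _.
  exact: alg_cover.
case: ifP => [/allP/(_ a ar) ax|_].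
  apply: le_trans ax _; apply: ler_sum => j _; apply: ler_wpM2l => //.
  by rewrite lerDl; have [/(_ j)/andP[]] := last_cheapP rV.
apply: le_trans (alg_cover rV ar) _; apply: ler_sum => j _; apply: ler_wpM2l => //.
by rewrite lerDr.
Qed.

(** The phases only move forward, since the cost of [alg] grows and a violated advice stays
    violated. At the first switch [last_cheap] is at least the previous output, and at the second it
    is at most the current one. *)
Lemma advised_rcons rows a : valid rows -> valid_row a ->
  forall j, advised rows j <= advised (rcons rows a) j.
Proof.
move=> rV aV j.
have raV : valid (rcons rows a).
  by move=> b; rewrite mem_rcons inE => /predU1P[->//|/rV].
have mono := alg_rcons rV aV; have [lc _ lcE] := last_cheapP rV.
have Fmono : F (alg rows) <= F (alg (rcons rows a)).
  by apply: F_mono => i; rewrite alg_ge0//=.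
rewrite /advised last_cheap_rcons all_rcons.
have [le'|gt'] := leP (F (alg (rcons rows a))) (F x').
  by rewrite (le_trans Fmono le').
have [le|gt] := leP (F (alg rows)) (F x').
  case: ifP => _; last by apply: ler_wpDl.
  by rewrite lcE//; apply: ler_wpDl.
rewrite lerD2l; case: (all _ rows); rewrite ?andbF//; case: ifP => // _.
by have /andP[_ lj] := lc j; apply: le_trans lj _.
Qed.

(** After the switch [F x' < F (alg rows)], and [F (last_cheap rows)] is at most both [F x'] and
    [F (alg rows)]; subadditivity gives all three bounds. *)
Lemma advised_cost rows : valid rows ->
  [/\ F (advised rows) <= F x' + F (alg rows), F (advised rows) <= F (alg rows) + F (alg rows) &
      all (fun a => 1 <= row_val a x') rows -> F (advised rows) <= F x' + F x'].
Proof.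
move=> rV; have [lc cheap _] := last_cheapP rV.
(* Nonnegativity comes from [F x <= F (x + x) <= F x + F x]. *)
have F0 x : (forall j, 0 <= x j) -> 0 <= F x.
  move=> x0; have : F x <= F (fun j => x j + x j).
    by apply: F_mono => j; rewrite lerDl x0.
  by move/(fun H => le_trans H (F_subadd x0 x0)); rewrite lerDl.
have Fa := F0 _ (alg_ge0 rV); have Fx := F0 _ x'_ge0.
have lc0 j : 0 <= last_cheap rows j by case/andP: (lc j).
have Flc : F (last_cheap rows) <= F (alg rows) by apply: F_mono.
rewrite /advised; have [le|gt] := leP (F (alg rows)) (F x').
  split=> [||_]; first by rewrite lerDr.
    by rewrite lerDl.
  by apply: (le_trans le); rewrite lerDl.
have Flcx := F_subadd x'_ge0 lc0; have Fax := F_subadd x'_ge0 (alg_ge0 rV).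
case: ifP => _; split=> //.
- by apply: le_trans Flcx _; apply: lerD.
- by apply: le_trans Flcx _; apply: lerD => //; exact: ltW.
- by move=> _; apply: le_trans Flcx _; apply: lerD.
- by apply: le_trans Fax _; apply: lerD => //; exact: ltW.
Qed.

End FollowAdvice.

(** * Assembling the guarantees *)

Lemma valid_rowsP (R : realType) (n : nat) (rows : seq ('I_n -> R)) :
  valid_rows rows -> {in rows, forall a, valid_row a}.
Proof. by move=> rV a /(nthP (fun=> 0))[k kr <-]; exact: rV. Qed.

Unset Implicit Arguments.

Theorem mainTheorem5 (R : realType) :
  exists (alg : OnlineAlg R) (C : R), 0 < C /\
  forall (n r : nat) (c : 'I_r -> R) (S : 'I_r -> {set 'I_n}) (q : 'I_r -> R)
         (x' : 'I_n -> R) (lam : R),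
    (forall e, 0 <= c e) -> (forall e, 1 <= q e) ->
    (forall j, 0 <= x' j) -> 0 < lam < 1 ->
    (* online behaviour: x only increases when a new row arrives *)
    (forall (rows : seq ('I_n -> R)) (a : 'I_n -> R),
        valid_rows rows -> valid_row a ->
        forall j, alg n r c S q x' lam rows j <= alg n r c S q x' lam (rcons rows a) j) /\
    (* guarantees for every (finite) sequence of arriving rows *)
    (forall rows : seq ('I_n -> R),
        valid_rows rows ->
        let xb := alg n r c S q x' lam rows in
        let k := kappa rows in
        let d := (dpar S rows)%:R in
        let opt := OPT c S q rows in
        feasible rows xb /\
        fobj c S q xb <=
          Num.min (C / (1 - lam) * fobj c S q x' + C * (1 + ln (k * d)) * opt)
                  (C * (1 + ln (k * d / lam)) * opt) /\
        (feasible rows x' -> fobj c S q xb <= C / (1 - lam) * fobj c S q x')).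
Proof.
(* The constant is [2 * 33]: the bound by twice the cost of [online] doubles its competitive
   constant. *)
exists (fun n r c S q x' lam => advised (fobj c S q) (online c S q) x'), 66.
split=> // n r c S q x' lam c0 q1 x'0 /andP[lam0 lam1].
have lam66 : 2 <= 66 / (1 - lam) by rewrite ler_pdivlMr; lra.
have Fm := le_fobj S c0 q1; have Fs := fobjD S c0 q1.
have Fx0 := fobj_ge0 S q c0 x'.
have nil : fobj c S q (online c S q [::]) <= fobj c S q x'.
  by rewrite online_nil (fobj0 c S q1).
have A0 := @online_ge0 R n r c S q c0 q1.
have Ac := @online_cover R n r c S q c0 q1.
have Ar := @online_rcons R n r c S q c0 q1.
split=> [rows a /valid_rowsP rV aV|rows /valid_rowsP rV xb k d opt].
  exact: (advised_rcons Fm x'0 nil A0 Ar rV aV).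
have [cost1 cost2 cost3] := advised_cost Fm Fs x'0 nil A0 Ar rV.
have le0 : 0 <= opt by apply: OPT_ge0.
have comp : fobj c S q (online c S q rows) <= 33 * (1 + ln (k * d)) * opt.
  exact: online_competitive.
(* With rows, [k * d >= 1] and [lam < 1]; without rows both logarithms are [ln 0 = 0]. *)
have lkd : 0 <= ln (k * d) <= ln (k * d / lam).
  have [r0|rn] := eqVneq rows [::].
    by rewrite /k /kappa r0 /amax !big_nil !mul0r ln0 ?lexx.
  have kd1 : 1 <= k * d := kappa_dpar_ge1 S rV rn.
  have kd0 := lt_le_trans ltr01 kd1.
  rewrite ln_ge0//= ler_ln ?posrE ?divr_gt0//.
  by rewrite ler_pdivlMr// ler_piMr// ltW.
have Cx : 2 * fobj c S q x' <= 66 / (1 - lam) * fobj c S q x'.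
  exact: ler_wpM2r Fx0 _ _ lam66.
rewrite -/xb in cost1 cost2 cost3.
split; [split|split].
- exact: (advised_ge0 x'0 nil A0 Ar rV).
- by apply/allP; exact: (advised_cover x'0 nil A0 Ac Ar rV).
- have /andP[l0 l1] := lkd.
  have L0 : 0 <= ln (k * d) * opt by apply: mulr_ge0.
  have L1 : ln (k * d) * opt <= ln (k * d / lam) * opt by apply: ler_wpM2r.
  rewrite le_min; clear -cost1 cost2 comp Cx Fx0 le0 L0 L1.
  move: cost1 cost2 comp Cx Fx0 le0 L0 L1.
  move: (66 / (1 - lam) * fobj c S q x') => cx.
  move: (fobj c S q x') (fobj c S q xb) (fobj c S q (online c S q rows)) opt => fx fb fo o.
  move: (ln (k * d)) (ln (k * d / lam)) => l l'.
  by move=> *; apply/andP; split; lra.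
- move=> [_ feas]; apply: le_trans (cost3 feas) _.
  by move: Cx; rewrite [2 * _]mulr_natl mulr2n.
Qed.
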